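(* Let $\gamma\in(0,2)$, $\theta\in\mathbb{R}$, $\kappa>0$, $N\ge2$ and $\alpha\le\beta$ in $(0,m^* )$. Let $\nu_{ss}^N$ be the stationary measure of the boundary driven zero-range process with parameters $\alpha,\beta$, and $\mu_{ss}^N$ the stationary measure of the boundary driven exclusion process (same $\gamma,\theta,\kappa,N$) with parameters $$\tilde\alpha=\frac{\Phi(\alpha)}{\Phi(\alpha)+\Phi(\beta)},\qquad\tilde\beta=\frac{\Phi(\beta)}{\Phi(\alpha)+\Phi(\beta)}.$$ Then, for all $x\in\Lambda_N$, $$E_{\nu_{ss}^N}[g(\xi(x))]=(\Phi(\alpha)+\Phi(\beta))\,E_{\mu_{ss}^N}[\eta(x)]=\varphi_N(x),$$ where $\varphi_N:\Lambda_N\to[\Phi(\alpha),\Phi(\beta)]$ is the unique solution of the traffic equation: for all $x\in\Lambda_N$, $$\varphi_N(x)\Big(\sum_{y\in\Lambda_N}p(y-x)+\kappa N^{-\theta}\big(r_N^+(\tfrac xN)+r_N^-(\tfrac xN)\big)\Big)=\sum_{y\in\Lambda_N}\varphi_N(y)p(y-x)+\frac{\kappa}{N^\theta}\Big(\Phi(\beta)r_N^+(\tfrac xN)+\Phi(\alpha)r_N^-(\tfrac xN)\Big).$$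
   Context: **Jump law.** $p(z)=c_\gamma|z|^{-1-\gamma}$ for $z\in\mathbb{Z}\setminus\{0\}$, $p(0)=0$, where $c_\gamma>0$ is the constant such that $\sum_{z\in\mathbb{Z}}p(z)=1$. $\Lambda_N=\{1,\dots,N-1\}$, $r_N^+(\frac xN)=\sum_{y\ge N}p(y-x)$, $r_N^-(\frac xN)=\sum_{y\le 0}p(y-x)$. **Functions attached to the rate $g$.** $g:\mathbb{N}_0\to[0,\infty)$ is non-decreasing, $g(0)=0$, $g(k)>0$ for $k\ge1$; $g(0)!=1$, $g(k)!=g(1)\cdots g(k)$; $\varphi^*=\liminf_{k\to\infty}g(k)\in(0,\infty]$; $Z(\varphi)=\sum_{k\ge0}\varphi^k/g(k)!$ for $\varphi\in[0,\varphi^* )$; $R(\varphi)=\varphi Z'(\varphi)/Z(\varphi)$, which is strictly increasing on $[0,\varphi^* )$; $m^*=\lim_{\varphi\uparrow\varphi^*}R(\varphi)$; $\Phi:[0,m^* )\to[0,\varphi^* )$ is the inverse of $R$. **Boundary driven zero-range process.** The continuous-time Markov process on $\Omega_N=\mathbb{N}_0^{\Lambda_N}$ with generator $L_N=L_N^b+\frac{\kappa}{N^\theta}(L_N^r+L_N^\ell)$, acting on bounded $f$ by $(L_N^bf)(\xi)=\sum_{x,y\in\Lambda_N}p(y-x)g(\xi(x))[f(\xi^{x,y})-f(\xi)]$, $(L_N^rf)(\xi)=\sum_{x\in\Lambda_N}r_N^+(\frac xN)\{\Phi(\beta)[f(\xi^{x,+})-f(\xi)]+g(\xi(x))[f(\xi^{x,-})-f(\xi)]\}$,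 $(L_N^\ell f)(\xi)=\sum_{x\in\Lambda_N}r_N^-(\frac xN)\{\Phi(\alpha)[f(\xi^{x,+})-f(\xi)]+g(\xi(x))[f(\xi^{x,-})-f(\xi)]\}$, where $\xi^{x,y}$ is $\xi$ with one particle moved from $x$ to $y$, and $\xi^{x,\pm}$ is $\xi$ with one particle added to/removed from $x$. $\nu_{ss}^N$ denotes its unique invariant probability measure. **Boundary driven exclusion process.** The continuous-time Markov process on $\{0,1\}^{\Lambda_N}$ with generator $\mathcal{L}_N=\mathcal{L}_N^b+\frac{\kappa}{N^\theta}(\mathcal{L}_N^r+\mathcal{L}_N^\ell)$, $(\mathcal{L}_N^bf)(\eta)=\frac12\sum_{x,y\in\Lambda_N}p(y-x)[f(\eta^{x,y})-f(\eta)]$, $(\mathcal{L}_N^\ell f)(\eta)=\sum_{x\in\Lambda_N}r_N^-(\frac xN)c_x(\eta;\tilde\alpha)[f(\eta^x)-f(\eta)]$, $(\mathcal{L}_N^rf)(\eta)=\sum_{x\in\Lambda_N}r_N^+(\frac xN)c_x(\eta;\tilde\beta)[f(\eta^x)-f(\eta)]$, where $\eta^{x,y}$ exchanges the values at $x$ and $y$, $\eta^x$ flips the value at $x$, and $c_x(\eta;\rho)=\eta(x)(1-\rho)+(1-\eta(x))\rho$. $\mu_{ss}^N$ denotes its unique invariant probability measure. *)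

(* Defs.v *)
From HB Require Import structures.
From mathcomp Require Import all_boot all_order all_algebra.
From mathcomp Require Import all_classical all_reals all_analysis.

Set Implicit Arguments.
Unset Strict Implicit.
Unset Printing Implicit Defensive.

Import Order.TTheory GRing.Theory Num.Theory.
Import numFieldNormedType.Exports.

Local Open Scope classical_set_scope.
Local Open Scope ring_scope.

Section markov_process.
Context {d : measure_display} {T : measurableType d} {R : realType}.

(* Only nonnegative times are meaningful. *)
Definition markov_semigroup (P : R -> R.-pker T ~> T) : Prop :=
  (forall x A, measurable A -> P 0 x A = \d_x A) /\
  (forall s t, 0 <= s -> 0 <= t -> forall x A, measurable A ->
     P (s + t) x A = (\int[P s x]_y P t y A)%E).

(* Pointwise generator on bounded functions. On a countable space with the
   discrete sigma-algebra this prescribes all the jump rates of the chain, so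
   that P is determined by L whenever the chain does not explode. *)
Definition has_generator (P : R -> R.-pker T ~> T)
    (L : (T -> R) -> T -> R) : Prop :=
  forall f : T -> R, measurable_fun setT f -> bounded_fun f ->
  forall x, ((\int[P t x]_y f y)%R - f x) / t @[t --> 0^'+] --> L f x.

Definition invariant_measure (P : R -> R.-pker T ~> T)
    (m : probability T R) : Prop :=
  forall t, 0 <= t -> forall A, measurable A -> (\int[m]_x P t x A)%E = m A.

Definition stationary_measure (L : (T -> R) -> T -> R)
    (m : probability T R) : Prop :=
  exists P : R -> R.-pker T ~> T,
    [/\ markov_semigroup P, has_generator P L & invariant_measure P m].

End markov_process.

(* The sites 1, ..., N - 1. *)
Definition Lambda (N : nat) : finType := {x : 'I_N | (0 < x)%N}.

Definition site {N : nat} (x : Lambda N) : int := (val (val x))%:Z.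

(* Configurations, with the discrete sigma-algebra; T is nat or bool. *)
Definition config (N : nat) (T : Type) : Type := {ffun Lambda N -> T}.

HB.instance Definition _ (N : nat) (T : choiceType) :=
  Choice.copy (config N T) {ffun Lambda N -> T}.

HB.instance Definition _ (N : nat) (T : pointedType) :=
  isPointed.Build (config N T) ([ffun=> point] : {ffun Lambda N -> T}).

HB.instance Definition _ (N : nat) (T : pointedType) :=
  @isMeasurable.Build default_measure_display (config N T)
    discrete_measurable discrete_measurable0
    discrete_measurableC discrete_measurableU.

Section jump_law.
Context {R : realType}.

Definition jump_law (c gamma : R) (z : int) : R :=
  if z == 0 then 0 else c * (`|z|%N%:R `^ (- 1 - gamma)).

Variables (p : int -> R) (N : nat).

Definition rplus (x : Lambda N) : R :=
  fine (\esum_(y in [set y : int | N%:Z <= y]) (p (y - site x))%:E).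

Definition rminus (x : Lambda N) : R :=
  fine (\esum_(y in [set y : int | y <= 0]) (p (y - site x))%:E).

End jump_law.

Section rate_functions.
Context {R : realType} (g : nat -> R).

Definition gfact (k : nat) : R := \prod_(1 <= i < k.+1) g i.

Definition phistar : \bar R := limn_einf (fun k => (g k)%:E).

Definition Zfun (phi : R) : R := limn (pseries (fun k => (gfact k)^-1) phi).

Definition Rfun (phi : R) : R := phi * derive1 Zfun phi / Zfun phi.

(* The case -oo is junk: phistar >= 0 when g is nonnegative. *)
Definition mstar : \bar R :=
  match phistar with
  | EFin r => lim ((Rfun phi)%:E @[phi --> r^'-])
  | +oo%E => lim ((Rfun phi)%:E @[phi --> +oo])
  | -oo%E => 0%E
  end.

Definition fugacities : set R := [set phi | 0 <= phi /\ (phi%:E < phistar)%E].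

Definition densities : set R := [set m | 0 <= m /\ (m%:E < mstar)%E].

(* Phi : [0, mstar) -> [0, phistar) is the inverse of Rfun; its values outside
   [0, mstar) are irrelevant. *)
Definition inverse_of_Rfun (Phi : R -> R) : Prop :=
  [/\ set_fun densities fugacities Phi,
      set_fun fugacities densities Rfun,
      (forall m, densities m -> Rfun (Phi m) = m) &
      (forall phi, fugacities phi -> Phi (Rfun phi) = phi)].

End rate_functions.

Section zero_range.
Context {R : realType} (p : int -> R) (kappa theta : R) (N : nat).
Variables (g : nat -> R) (phi_l phi_r : R).
Implicit Types (xi : config N nat) (f : config N nat -> R).

Definition add_particle (x : Lambda N) xi : config N nat :=
  [ffun z => if z == x then (xi z).+1 else xi z].

Definition remove_particle (x : Lambda N) xi : config N nat :=
  [ffun z => if z == x then (xi z).-1 else xi z].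

(* When xi x = 0 this is not a jump, but its rate g (xi x) is then g 0 = 0. *)
Definition move_particle (x y : Lambda N) xi : config N nat :=
  add_particle y (remove_particle x xi).

Definition zr_bulk f xi : R :=
  \sum_(x : Lambda N) \sum_(y : Lambda N)
    p (site y - site x) * g (xi x) * (f (move_particle x y xi) - f xi).

Definition zr_reservoir (r : Lambda N -> R) (phi : R) f xi : R :=
  \sum_(x : Lambda N) r x *
    (phi * (f (add_particle x xi) - f xi)
     + g (xi x) * (f (remove_particle x xi) - f xi)).

Definition zr_generator f xi : R :=
  zr_bulk f xi + kappa / N%:R `^ theta *
    (zr_reservoir (rplus p (N := N)) phi_r f xi
     + zr_reservoir (rminus p (N := N)) phi_l f xi).

End zero_range.

Section exclusion.
Context {R : realType} (p : int -> R) (kappa theta : R) (N : nat).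
Variables (rho_l rho_r : R).
Implicit Types (eta : config N bool) (f : config N bool -> R).

Definition exchange (x y : Lambda N) eta : config N bool :=
  [ffun z => if z == x then eta y else if z == y then eta x else eta z].

Definition flip (x : Lambda N) eta : config N bool :=
  [ffun z => if z == x then ~~ eta z else eta z].

Definition flip_rate (x : Lambda N) eta (rho : R) : R :=
  (eta x)%:R * (1 - rho) + (1 - (eta x)%:R) * rho.

Definition ex_bulk f eta : R :=
  2^-1 * \sum_(x : Lambda N) \sum_(y : Lambda N)
    p (site y - site x) * (f (exchange x y eta) - f eta).

Definition ex_reservoir (r : Lambda N -> R) (rho : R) f eta : R :=
  \sum_(x : Lambda N) r x * flip_rate x eta rho * (f (flip x eta) - f eta).

Definition ex_generator f eta : R :=
  ex_bulk f eta + kappa / N%:R `^ theta *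
    (ex_reservoir (rplus p (N := N)) rho_r f eta
     + ex_reservoir (rminus p (N := N)) rho_l f eta).

End exclusion.

Definition traffic_equation {R : realType} (p : int -> R) (kappa theta : R)
    (N : nat) (phi_l phi_r : R) (phi : Lambda N -> R) : Prop :=
  forall x : Lambda N,
    phi x * (\sum_(y : Lambda N) p (site y - site x)
             + kappa * N%:R `^ (- theta) * (rplus p x + rminus p x))
    = \sum_(y : Lambda N) phi y * p (site y - site x)
      + kappa / N%:R `^ theta * (phi_r * rplus p x + phi_l * rminus p x).

(* Main.v *)
(* The exclusion process lives on a finite space, so averaging the generator of
   [eta x] against its stationary measure shows that [(Phi alpha + Phi beta)]
   times the mean occupation solves the traffic equation; a maximum principle
   gives uniqueness and the bounds on the solution [phi].

   For the zero-range process the infinite state space and the unbounded [g]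
   forbid integrating the generator of [g (xi x)]. Instead, testing invariance
   on singletons and letting [t] tend to 0 in finite sums shows that a stationary
   [nu] is subinvariant for the jump rates. The product weight [pi] with
   fugacities [phi x] is invariant and has finite total jump rate, and this forces
   [nu / pi] to be the same at [xi] and at [xi] with one particle added. Hence
   [nu (xi + e_x) * g (xi x + 1) = phi x * nu xi], and summing over [xi] gives
   [E_nu [g (xi x)] = phi x]. *)

Require Import Defs.
From mathcomp Require Import all_boot all_order all_algebra.
From mathcomp Require Import all_classical all_reals all_analysis.
From mathcomp Require Import ring lra.

Import Order.TTheory GRing.Theory Num.Theory.
Import numFieldNormedType.Exports.

Local Open Scope classical_set_scope.
Local Open Scope ring_scope.

(** * Power series and the density function *)

Section power_series.
Set Implicit Arguments.
Unset Strict Implicit.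
Variable R : realType.
Implicit Types (c : nat -> R) (x z : R).

(** The linear factor [k + 1] is absorbed by a slightly larger ratio: by a Bernoulli bound [k + 1]
    is at most [(1 + d)^k / d], and [d] is small enough that [|z| (1 + d)] is at most [m], which
    lies below [|x|]. *)
Lemma is_cvg_pseries_diffs_inside c x z :
  cvgn (pseries c x) -> `|z| < `|x| -> cvgn (pseries (pseries_diffs c) z).
Proof.
move=> cx zx.
pose m := (`|z| + `|x|) / 2; pose d := (m - `|z|) / (m + 1).
have z0 := normr_ge0 z.
have zm : `|z| < m by rewrite /m; lra.
have mx : m < `|x| by rewrite /m; lra.
have d0 : 0 < d by rewrite divr_gt0//; lra.
have dE : d * (m + 1) = m - `|z| by rewrite mulfVK//; lra.
have d1 : d <= 1 by rewrite /d ler_pdivrMr; lra.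
have zdm : `|z| * (1 + d) <= m.
  rewrite mulrDr mulr1 -lerBrDl -dE mulrC ler_pM2l//; lra.
have m0 : 0 < m by lra.
clearbody d m.
have bern k : k.+1%:R <= d^-1 * (1 + d) ^+ k.
  rewrite ler_pdivlMl// ; elim: k => [|k IH]; first by rewrite mulr1 expr0.
  rewrite exprSr -natr1 mulrDr mulr1 [leRHS]mulrDr mulr1 lerD//.
  by rewrite ler_peMl ?(ltW d0)// exprn_ege1//; lra.
have cm : cvgn (pseries (fun i => `|c i|) m).
  by apply: is_cvg_pseries_inside_norm cx _; rewrite gtr0_norm.
have cm1 : cvgn (series (fun i => (d * m)^-1 * (`|c i.+1| * m ^+ i.+1))).
  apply: (@is_cvg_seriesZ _ (fun i => `|c i.+1| * m ^+ i.+1)).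
  have -> : series (fun i => `|c i.+1| * m ^+ i.+1) =
      (fun n => pseries (fun i => `|c i|) m n.+1 - `|c 0%N| * m ^+ 0).
    by apply/funext => n; rewrite /pseries /series/= big_nat_recl// [X in X - _]addrC addrK.
  apply: is_cvgB; last exact: is_cvg_cst.
  apply: (cvgP (limn (pseries (fun i => `|c i|) m))).
  by rewrite (cvg_shiftS (pseries (fun i => `|c i|) m)).
apply: normed_cvg; apply: series_le_cvg cm1 => [k|k|k].
- exact: normr_ge0.
- by rewrite /= !mulr_ge0 ?invr_ge0 ?mulr_ge0 ?exprn_ge0 ?(ltW d0) ?(ltW m0).
- rewrite /= /pseries_diffs /= !normrM normrX normr_nat exprS.
  have -> : (d * m)^-1 * (`|c k.+1| * (m * m ^+ k)) = `|c k.+1| * (d^-1 * m ^+ k).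
    by field; rewrite !gt_eqF.
  rewrite mulrAC mulrC ler_wpM2l//.
  apply: (@le_trans _ _ (d^-1 * (1 + d) ^+ k * `|z| ^+ k)).
    by rewrite ler_wpM2r ?exprn_ge0.
  rewrite -mulrA ler_wpM2l ?invr_ge0 ?(ltW d0)// -exprMn mulrC lerXn2r ?nnegrE//.
    by rewrite mulr_ge0//; lra.
  exact: ltW.
Qed.


(* Chebyshev: the first moment of the weights [c k * x ^+ k] increases with [x]. *)
Lemma chebyshev_moment c x z n : (forall k, 0 <= c k) -> 0 <= x -> x <= z ->
  (\sum_(0 <= k < n) k%:R * c k * x ^+ k) * (\sum_(0 <= k < n) c k * z ^+ k)
  <= (\sum_(0 <= k < n) k%:R * c k * z ^+ k) * (\sum_(0 <= k < n) c k * x ^+ k).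
Proof.
move=> c0 x0 xz; have z0 := le_trans x0 xz.
elim: n => [|n IH]; first by rewrite !big_nil mul0r.
rewrite !big_nat_recr//= !mulrDl !mulrDr.
set Bx := \sum_(_ <= _ < _) _ in IH *; set Az := \sum_(_ <= _ < _) _ in IH *.
set Bz := \sum_(_ <= _ < _) _ in IH *; set Ax := \sum_(_ <= _ < _) _ in IH *.
(* Beyond the induction hypothesis, what remains is the interaction of index [n] with each [k < n],
   namely [c n * c k * (n - k) * (x^k z^n - x^n z^k)]. *)
suff : 0 <= c n * (n%:R * z ^+ n * Ax + x ^+ n * Bz
                   - n%:R * x ^+ n * Az - z ^+ n * Bx) by nra.
rewrite mulr_ge0// /Ax /Az /Bx /Bz !mulr_sumr -big_split/= -!sumrB.
rewrite big_nat_cond sumr_ge0// => k /andP[/andP[_ kn] _].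
have -> : n%:R * z ^+ n * (c k * x ^+ k) + x ^+ n * (k%:R * c k * z ^+ k)
    - n%:R * x ^+ n * (c k * z ^+ k) - z ^+ n * (k%:R * c k * x ^+ k)
  = c k * ((n - k)%:R * (x ^+ k * z ^+ k * (z ^+ (n - k) - x ^+ (n - k)))).
  have split_pow y : y ^+ n = y ^+ k * y ^+ (n - k) by rewrite -exprD subnKC// ltnW.
  by rewrite natrB ?(ltnW kn)// !split_pow; ring.
rewrite !mulr_ge0// ?exprn_ge0// subr_ge0 lerXn2r//.
Qed.

End power_series.

Section rate.
Set Implicit Arguments.
Unset Strict Implicit.
Variables (R : realType) (g : nat -> R).
Hypothesis g_mono : {homo g : k l / (k <= l)%N >-> k <= l}.
Hypothesis g_pos : forall k : nat, (1 <= k)%N -> 0 < g k.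

Lemma gfact_gt0 k : 0 < gfact g k.
Proof.
by rewrite /gfact big_nat_cond prodr_gt0// => i /andP[/andP[i1 _] _]; exact: g_pos.
Qed.

Lemma gfactS k : gfact g k.+1 = gfact g k * g k.+1.
Proof. by rewrite /gfact big_nat_recr. Qed.

Lemma lt_phistar phi : (phi%:E < phistar g)%E -> exists k, phi < g k.
Proof.
move=> h; apply: contrapT => /forallNP gphi; move: h; apply/negP; rewrite -leNgt.
rewrite /phistar limn_einf_lim; apply: lime_le; first exact: is_cvg_einfs.
near=> n; apply: (@le_trans _ _ (g n)%:E).
  by apply: ereal_inf_lbound; exists n => /=.
by rewrite lee_fin leNgt; apply/negP; exact: gphi.
Unshelve. all: by end_near. Qed.

(** Only the first [k] factors can lie below [g k], and the constant [C] pays for them; every later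
    factor is at least [g k] by monotonicity. *)
Lemma gfact_geometric_lb k : 0 < g k ->
  exists2 C, 0 < C & forall n, C * g k ^+ n <= gfact g n.
Proof.
move=> gk0.
have [C C0 CK] : exists2 C, 0 < C & forall n, (n <= k)%N -> C * g k ^+ n <= gfact g n.
  (* Induction on the bound for [n] only; the base [g k] stays fixed. *)
  elim: {-2}k => [|K [C C0 IH]].
    exists 1 => // n; rewrite leqn0 => /eqP ->.
    by rewrite /gfact big_geq// expr0 mulr1.
  exists (Num.min C (gfact g K.+1 / g k ^+ K.+1)).
    by rewrite lt_min C0 divr_gt0 ?exprn_gt0 ?gfact_gt0.
  move=> n; rewrite leq_eqVlt => /predU1P[->|].
    by rewrite -ler_pdivlMr ?exprn_gt0// ge_min lexx orbT.
  rewrite ltnS => nK; apply: le_trans (IH n nK).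
  by rewrite ler_wpM2r ?exprn_ge0 ?(ltW gk0)// ge_min lexx.
exists C => // n; have [/CK//|kn] := leqP n k.
rewrite -(subnK (ltnW kn)); elim: (n - k)%N => [|m IH]; first exact: CK.
rewrite addSn exprSr gfactS mulrA ler_pM ?mulr_ge0 ?exprn_ge0 ?(ltW C0) ?(ltW gk0)//.
by apply: g_mono; rewrite leqW// leq_addl.
Qed.

(** Some [g k] exceeds [phi], and strictly between the two the series for [Z] is dominated by a
    geometric one. The room beyond [phi] later allows termwise differentiation. *)
Lemma lt_phistar_cvg phi : 0 <= phi -> (phi%:E < phistar g)%E ->
  exists2 r, phi < r & cvgn (pseries (fun k => (gfact g k)^-1) r).
Proof.
move=> phi0 /lt_phistar[k gk].
pose r := (phi + g k) / 2; have [phir rg] : phi < r /\ r < g k by rewrite /r; lra.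
exists r => //.
have r0 : 0 < r by lra.
have gk0 : 0 < g k by lra.
clearbody r.
have [C C0 Cg] := gfact_geometric_lb gk0.
have : cvgn (series (geometric C^-1 (r / g k))).
  by apply: is_cvg_geometric_series; rewrite gtr0_norm ?divr_gt0// ltr_pdivrMr// mul1r.
apply: series_le_cvg => n /=.
- by rewrite mulr_ge0 ?invr_ge0 ?exprn_ge0 ?(ltW (gfact_gt0 _)) ?ltW.
- by rewrite mulr_ge0 ?invr_ge0 ?exprn_ge0 ?divr_ge0 ?(ltW C0) ?(ltW r0) ?(ltW gk0).
- rewrite expr_div_n mulrA mulrAC ler_pM2r ?exprn_gt0//.
  by rewrite -invfM lef_pV2 ?posrE ?mulr_gt0 ?exprn_gt0 ?gfact_gt0.
Qed.

(** [Rfun] is a quotient of limits of partial sums, and [chebyshev_moment] compares these sums at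
    every cutoff. *)
Lemma Rfun_homo phi psi : 0 <= phi -> phi <= psi -> (psi%:E < phistar g)%E ->
  Rfun g phi <= Rfun g psi.
Proof.
move=> phi0 phipsi psis; have psi0 := le_trans phi0 phipsi.
have [r psir cr] := lt_phistar_cvg psi0 psis.
pose c k := (gfact g k)^-1.
have c0 k : 0 <= c k by rewrite invr_ge0 ltW// gfact_gt0.
have key x : 0 <= x -> x < r ->
    exists M Z, [/\ 0 < Z, Rfun g x = M / Z,
      \sum_(0 <= k < n) k%:R * c k * x ^+ k @[n --> \oo] --> M &
      \sum_(0 <= k < n) c k * x ^+ k @[n --> \oo] --> Z].
  (* Each termwise differentiation costs a smaller disc, and differentiating [Z] at [x] asks for the
     series and its first two derived series at a radius beyond [x]. *)
  move=> x0 xr; pose K1 := (x + r) / 2; pose K2 := (K1 + r) / 2; pose K0 := (x + K1) / 2.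
  have [xK0 K01 K12 K2r] : [/\ x < K0, K0 < K1, K1 < K2 & K2 < r].
    by rewrite /K2 /K0 /K1; split; lra.
  have nK a b : 0 <= a -> a < b -> `|a| < `|b|.
    by move=> a0 ab; rewrite !ger0_norm// ltW// (le_lt_trans a0).
  have cv0 : cvgn (pseries c K0) by apply: is_cvg_pseries_inside cr _; apply: nK; lra.
  have cd2 : cvgn (pseries (pseries_diffs c) K2).
    by apply: is_cvg_pseries_diffs_inside cr _; apply: nK; lra.
  have cd0 : cvgn (pseries (pseries_diffs c) K0).
    by apply: is_cvg_pseries_inside cd2 _; apply: nK; lra.
  have cdd0 : cvgn (pseries (pseries_diffs (pseries_diffs c)) K0).
    by apply: is_cvg_pseries_diffs_inside cd2 _; apply: nK; lra.
  have xK : `|x| < `|K0| by apply: nK.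
  have cx := is_cvg_pseries_inside cv0 xK.
  have cdx := is_cvg_pseries_inside cd0 xK.
  have dZ := pseries_snd_diffs cv0 cd0 cdd0 xK.
  exists (x * limn (pseries (pseries_diffs c) x)), (limn (pseries c x)); split.
  - apply: (@lt_le_trans _ _ (c 0%N)); first by rewrite invr_gt0 gfact_gt0.
    apply: limr_ge => //; near=> n.
    have n0 : (0 < n)%N by near: n; exists 1%N.
    rewrite /pseries/= /series/= -(prednK n0) big_nat_recl// expr0 mulr1 lerDl.
    by rewrite sumr_ge0// => i _; rewrite mulr_ge0// exprn_ge0.
  - by rewrite /Rfun derive1E; congr (_ * _ / _); exact: derive_val.
  - have -> : (fun n => \sum_(0 <= k < n) k%:R * c k * x ^+ k) =
        x \*o series (fun i => i%:R * c i * x ^+ i.-1).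
      apply/funext => n /=; rewrite /series/= mulr_sumr; apply: eq_bigr => -[|i] _ /=.
        by rewrite !mul0r mulr0.
      by rewrite exprS; ring.
    by apply: cvgMr; exact: pseries_diffs_equiv.
  - exact: cx.
have [M1 [Z1 [Z10 -> M1c Z1c]]] := key phi phi0 (le_lt_trans phipsi psir).
have [M2 [Z2 [Z20 -> M2c Z2c]]] := key psi psi0 psir.
rewrite ler_pdivrMr// mulrAC ler_pdivlMr//.
apply: ler_cvg_to (cvgM M1c Z2c) (cvgM M2c Z1c) _.
by near=> n; apply: chebyshev_moment.
Unshelve. all: by end_near. Qed.

End rate.

(** * Stationary measures on discrete spaces *)

Section discrete.
Set Implicit Arguments.
Unset Strict Implicit.
Context (d : measure_display) (T : measurableType d) (R : realType).
Hypothesis discreteT : forall A : set T, measurable A.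

Lemma discrete_measurable_fun d' (U : sigmaRingType d') (D : set T) (f : T -> U) :
  measurable_fun D f.
Proof. by move=> _ Y _; exact: discreteT. Qed.

(** The injection [e] encodes countability: its fibres cut [T] into a sequence of pieces with at
    most one point each. *)
Lemma ge0_integral_esum (m : {measure set T -> \bar R}) (e : T -> nat)
    (f : T -> \bar R) : injective e -> (forall x, (0 <= f x)%E) ->
  (\int[m]_x f x = \esum_(x in [set: T]) (f x * m [set x]))%E.
Proof.
move=> e_inj f0; pose F k := [set x | e x = k].
have FT : \bigcup_k F k = [set: T] by apply/seteqP; split => // x _; exists (e x).
have tF : trivIset [set: nat] F by move=> i j _ _ [x [/= <- <-]].
rewrite -{1}FT ge0_integral_bigcup//.
rewrite -FT.
rewrite nneseries_sum_bigcup//; last by move=> x; rewrite mule_ge0.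
apply: eq_eseriesr => k _.
have [[x xk]|/forallNP Fk] := pselect (exists x, F k x); last first.
  have -> : F k = set0 by apply/seteqP; split => // x /Fk.
  by rewrite integral_set0 esum_set0.
have -> : F k = [set x].
  apply/seteqP; split => [y|_ ->//]; rewrite /F/= => yk; apply: e_inj.
  by rewrite yk.
rewrite esum_set1; last by rewrite mule_ge0.
rewrite (eq_integral (fun=> f x)); last by move=> y; rewrite inE => ->.
by rewrite integral_cst.
Qed.

(** For [t > 0], invariance bounds the mass found at [z] after starting in [s] by [m [set z]], since
    leaving out the other starting points only loses mass. Subtracting [m [set z]], dividing by [t]
    and letting [t] tend to 0 gives the claim; the limit passes through the sum because [s] is
    finite. *)
Lemma stationary_measure_subinvariant (L : (T -> R) -> T -> R)
    (m : probability T R) (s : seq T) (z : T) :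
  stationary_measure L m -> uniq s -> z \in s ->
  \sum_(y <- s) fine (m [set y]) * L \1_[set z] y <= 0.
Proof.
move=> [P [_ genP invP]] us zs.
pose q t y : R := fine (P t y [set z]).
have qE t y : (q t y)%:E = P t y [set z].
  rewrite fineK// ge0_fin_numE//; apply: (@le_lt_trans _ _ 1%E); last exact: ltry.
  apply: le_trans (sprob_kernel_le1 (P t) y).
  by apply: le_measure => //; rewrite inE; exact: discreteT.
have mE y : (fine (m [set y]))%:E = m [set y] by rewrite fineK// fin_num_measure.
have cv : (\sum_(y <- s) fine (m [set y]) * ((q t y - \1_[set z] y) / t))
    @[t --> 0^'+] --> \sum_(y <- s) fine (m [set y]) * L \1_[set z] y.
  apply: cvg_big; first exact: add_continuous.
  move=> y _; apply: cvgMr.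
  have bz : bounded_fun (\1_[set z] : T -> R).
    exists 1; split; first exact: num_real.
    move=> M M1 x _ /=; rewrite indicE normr_nat (le_trans _ (ltW M1))//.
    by case: (_ \in _).
  apply: cvg_trans (genP _ (discrete_measurable_fun _) bz y).
  suff -> : (fun t => (q t y - \1_[set z] y) / t)
      = (fun t => ((\int[P t y]_x \1_[set z] x)%R - \1_[set z] y) / t) by [].
  apply/funext => t; rewrite /Rintegral integral_indic ?setIT//.
have le0 : \forall t \near 0^'+,
    \sum_(y <- s) fine (m [set y]) * ((q t y - \1_[set z] y) / t) <= 0.
  near=> t.
  have t0 : 0 < t by [].
  suff : \sum_(y <- s) fine (m [set y]) * q t y <= fine (m [set z]).
    move=> h.
    under eq_bigr do rewrite mulrA mulrBr.
    rewrite -mulr_suml sumrB ler_pdivrMr// mul0r subr_le0 (le_trans h)//.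
    rewrite (bigD1_seq z)//= indicE mem_set// mulr1 big1 ?addr0// => y yz.
    by rewrite indicE memNset ?mulr0//= => /eqP; exact/negP.
  (* Invariance writes [m [set z]] as the integral of [q t], which dominates the function equal to
     [q t] on [s] and to 0 elsewhere. *)
  rewrite -lee_fin mE -(invP t (ltW t0) _ (discreteT _)) -sumEFin.
  rewrite (eq_bigr (fun y => \int[m]_x (q t y * \1_[set y] x)%:E)%E); last first.
    move=> y _; under eq_integral do rewrite EFinM.
    rewrite ge0_integralZl//=; last by rewrite lee_fin fine_ge0.
    by rewrite integral_indic// setIT EFinM mE muleC.
  rewrite -ge0_integral_sum//; last 2 first.
    by move=> y; exact: discrete_measurable_fun.
    by move=> y x _; rewrite lee_fin mulr_ge0// fine_ge0.
  apply: ge0_le_integral => //.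
  - by move=> x _; apply: sume_ge0 => y _; rewrite lee_fin mulr_ge0// fine_ge0.
  - move=> x _; rewrite -qE sumEFin lee_fin.
    have [xs|xs] := boolP (x \in s).
      rewrite (bigD1_seq x)//= indicE mem_set// mulr1 big1 ?addr0// => y yx.
      by rewrite indicE memNset ?mulr0//= => /eqP; rewrite eq_sym; exact/negP.
    rewrite big_seq big1 ?fine_ge0// => y ys.
    rewrite indicE memNset ?mulr0//= => xy; by rewrite xy ys in xs.
exact: cvgr_to_le cv le0.
Unshelve. all: by end_near. Qed.

End discrete.

(** * Subinvariant measures of jump processes *)

Section esum_complements.
Set Implicit Arguments.
Unset Strict Implicit.
Variable R : realType.
Local Open Scope ereal_scope.

(** One inequality holds for every nonnegative factor; for [r > 0] the other is the same inequality
    applied to [r^-1]. *)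
Lemma esumZl (S : choiceType) (a : S -> \bar R) (r : R) :
  (0 <= r)%R -> (forall x, 0 <= a x) ->
  \esum_(x in [set: S]) (r%:E * a x) = r%:E * \esum_(x in [set: S]) a x.
Proof.
move=> r0 a0.
have le (t : R) (b : S -> \bar R) : (0 <= t)%R -> (forall x, 0 <= b x) ->
    \esum_(x in [set: S]) (t%:E * b x) <= t%:E * \esum_(x in [set: S]) b x.
  move=> t0 b0; apply: ge_ereal_sup => _ [X [finX _] <-].
  rewrite -ge0_mule_fsumr// lee_wpmul2l ?lee_fin//.
  by apply: ereal_sup_ubound; exists X.
move: r0; rewrite le_eqVlt => /predU1P[<-|r0].
  by rewrite mul0e esum1// => x _; rewrite mul0e.
apply/eqP; rewrite eq_le le ?(ltW r0)//= -lee_pdivlMl//.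
apply: le_trans (le _ _ _ _); rewrite ?invr_ge0 ?(ltW r0)//; last first.
  by move=> x; rewrite mule_ge0// lee_fin ltW.
by apply: le_esum => x _; rewrite muleA -EFinM mulVf ?gt_eqF// mul1e.
Qed.

(** After exchanging the sums, each [x] is counted for exactly one [z]. *)
Lemma esum_fiber (S S' : choiceType) (f : S -> S') (h : S -> \bar R) :
  (forall x, 0 <= h x) ->
  \esum_(z in [set: S']) \esum_(x in [set: S]) (h x * (f x == z)%:R%:E)
  = \esum_(x in [set: S]) h x.
Proof.
move=> h0.
have t0 x z : 0 <= h x * (f x == z)%:R%:E by rewrite mule_ge0// lee_fin ler0n.
rewrite (esum_esum (J := fun=> setT))//.
rewrite (reindex_esum ([set: S] `*`` fun=> [set: S']) _ (fun k => (k.2, k.1))).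
  rewrite -(esum_esum (a := fun x z => h x * (f x == z)%:R%:E))//.
  apply: eq_esum => x _; rewrite (esumID [set f x])// setTI [X in _ + X]esum1.
    by rewrite adde0 esum_set1// eqxx mule1.
  by move=> z [_ /= /eqP]; rewrite eq_sym => /negbTE ->; rewrite mule0.
split=> //.
- by move=> [x z] [y u] /= _ _ [-> ->].
- by move=> [z x] _; exists (x, z).
Qed.

(** Serves the zero-range jumps, where for a given map at most one configuration can reach [z] with
    positive weight. *)
Lemma esum_preimage (S S' : choiceType) (f : S -> S') (h : S -> \bar R)
    (z : S') (u : S) :
  (forall x, 0 <= h x) -> (forall x, h x != 0 -> f x = z -> x = u) ->
  \esum_(x in [set: S]) (h x * (f x == z)%:R%:E) = h u * (f u == z)%:R%:E.
Proof.
move=> h0 hu; have t0 x : 0 <= h x * (f x == z)%:R%:E.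
  by rewrite mule_ge0// lee_fin ler0n.
rewrite (esumID [set u])// setTI esum_set1// esum1 ?adde0// => x [_ /= xu].
have [fx|] := eqVneq (f x) z; last by rewrite mule0.
have [->|hx] := eqVneq (h x) 0; first by rewrite mul0e.
by case: xu; exact: hu.
Qed.

(** A strict inequality at one point would survive adding the remaining terms, because these have a
    finite sum. *)
Lemma eq_esum_termwise (S : choiceType) (a b : S -> \bar R) :
  (forall x, 0 <= a x) -> (forall x, a x <= b x) ->
  \esum_(x in [set: S]) a x = \esum_(x in [set: S]) b x ->
  \esum_(x in [set: S]) b x < +oo -> forall x, a x = b x.
Proof.
move=> a0 ab eab boo z; have b0 x : 0 <= b x := le_trans (a0 x) (ab x).
have split_at (c : S -> \bar R) : (forall x, 0 <= c x) ->
    \esum_(x in [set: S]) c x = c z + \esum_(x in [set~ z]) c x.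
  by move=> c0; rewrite (esumID [set z])// !setTI esum_set1.
apply/eqP; rewrite eq_le ab/= leNgt; apply/negP => abz.
move: eab boo; rewrite !split_at// => eab boo.
have bz : \esum_(x in [set~ z]) b x \is a fin_num.
  rewrite ge0_fin_numE ?esum_ge0// (le_lt_trans _ boo)// leeDr//.
suff : a z + \esum_(x in [set~ z]) a x < b z + \esum_(x in [set~ z]) b x.
  by rewrite eab ltxx.
have ab' : \esum_(x in [set~ z]) a x <= \esum_(x in [set~ z]) b x by exact: le_esum.
apply: lte_leD => //; rewrite ge0_fin_numE ?esum_ge0// (le_lt_trans ab')//.
by rewrite -ge0_fin_numE ?esum_ge0.
Qed.

End esum_complements.

Section jump_process.
Set Implicit Arguments.
Unset Strict Implicit.
Variables (R : realType) (S : choiceType) (I : finType).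
Variables (T : I -> S -> S) (a : I -> S -> R).
Hypothesis a_ge0 : forall i y, 0 <= a i y.

(** Jumps are given by finitely many maps [T i] with rates [a i]. A map that fixes a state counts in
    both [inflow] and [outflow], so such void jumps cancel in the balance. *)
Definition inflow (w : S -> R) (z : S) : \bar R :=
  \esum_(y in [set: S]) (w y * \sum_i a i y * (T i y == z)%:R)%:E.

Definition outflow (w : S -> R) (z : S) : R := w z * \sum_i a i z.

Let flow_ge0 (w : S -> R) y z : (forall y, 0 <= w y) ->
  0 <= w y * \sum_i a i y * (T i y == z)%:R.
Proof.
by move=> w0; rewrite mulr_ge0// sumr_ge0// => i _; rewrite mulr_ge0.
Qed.

Lemma inflow_ge0 w z : (forall y, 0 <= w y) -> (0 <= inflow w z)%E.
Proof. by move=> w0; apply: esum_ge0 => y _; rewrite lee_fin flow_ge0. Qed.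

Lemma le_inflow w w' z : (forall y, w y <= w' y) -> (inflow w z <= inflow w' z)%E.
Proof.
move=> ww; apply: le_esum => y _; rewrite lee_fin ler_wpM2r//.
by apply: sumr_ge0 => i _; rewrite mulr_ge0.
Qed.

Lemma inflowZ r w z : 0 <= r -> (forall y, 0 <= w y) ->
  inflow (fun y => r * w y) z = (r%:E * inflow w z)%E.
Proof.
move=> r0 w0; rewrite -esumZl//; last by move=> y; rewrite lee_fin flow_ge0.
by apply: eq_esum => y _; rewrite -EFinM mulrA.
Qed.

Lemma inflow_sum w z : (forall y, 0 <= w y) ->
  inflow w z = (\sum_i \esum_(y in [set: S]) (w y * a i y * (T i y == z)%:R)%:E)%E.
Proof.
move=> w0; rewrite -esum_sum; last first.
  by move=> y i _ _; rewrite lee_fin !mulr_ge0.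
apply: eq_esum => y _; rewrite mulr_sumr sumEFin; congr EFin.
by apply: eq_bigr => i _; rewrite mulrA.
Qed.

(** Each jump out of a state lands in exactly one state, so exchanging the sums proves the equality,
    possibly with both sides infinite. *)
Lemma total_inflow w : (forall y, 0 <= w y) ->
  (\esum_(z in [set: S]) inflow w z = \esum_(z in [set: S]) (outflow w z)%:E)%E.
Proof.
move=> w0; under eq_esum do rewrite inflow_sum//.
rewrite esum_sum; last first.
  by move=> z i _ _; apply: esum_ge0 => y _; rewrite lee_fin !mulr_ge0.
under eq_bigr => i _.
  under eq_esum do under eq_esum do rewrite EFinM.
  rewrite esum_fiber; last by move=> x; rewrite lee_fin mulr_ge0.
  over.
rewrite -esum_sum; last by move=> y i _ _; rewrite lee_fin mulr_ge0.
by apply: eq_esum => y _; rewrite sumEFin /outflow mulr_sumr.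
Qed.

Section subinvariant.
Variables (nu pi : S -> R).
Hypothesis nu_ge0 : forall y, 0 <= nu y.
Hypothesis pi_gt0 : forall y, 0 < pi y.
Hypothesis nu_subinvariant : forall z, (inflow nu z <= (outflow nu z)%:E)%E.
Hypothesis pi_invariant : forall z, (inflow pi z = (outflow pi z)%:E)%E.
Hypothesis pi_summable : (\esum_(z in [set: S]) (outflow pi z)%:E < +oo)%E.

(* The minimum of two subinvariant measures is subinvariant, and a subinvariant
   measure with finite total flow is invariant. Cutting [nu] off at the multiple
   of [pi] that touches it at [T i y] forces the two measures to be ordered at
   every site that feeds [T i y]. *)
Lemma subinvariant_ratio_le i y : 0 < a i y ->
  nu (T i y) / pi (T i y) <= nu y / pi y.
Proof.
move=> aiy; set z := T i y; set c := nu z / pi z.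
have c0 : 0 <= c by rewrite divr_ge0// ltW.
have czE : c * pi z = nu z by rewrite mulfVK// gt_eqF.
have pi_ge0 x : 0 <= pi x := ltW (pi_gt0 x).
pose w x := Num.min (nu x) (c * pi x).
have w_nu x : w x <= nu x by rewrite ge_min lexx.
have w_pi x : w x <= c * pi x by rewrite ge_min lexx orbT.
have w0 x : 0 <= w x by rewrite le_min nu_ge0 mulr_ge0.
have wz : w z = nu z by rewrite /w czE minxx.
have sum_ge0 x : 0 <= \sum_i a i x by rewrite sumr_ge0.
have out0 v x : 0 <= v x -> (0 <= (outflow v x)%:E)%E.
  by move=> v0; rewrite lee_fin mulr_ge0.
have cpi_inv x : inflow (fun y => c * pi y) x = (c * outflow pi x)%:E.
  by rewrite inflowZ// pi_invariant.
have w_sub x : (inflow w x <= (outflow w x)%:E)%E.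
  have [wx|wx] : w x = nu x \/ w x = c * pi x by rewrite /w; case: leP; [left|right].
    rewrite /outflow wx; exact: le_trans (le_inflow _ w_nu) (nu_subinvariant x).
  by rewrite /outflow wx -mulrA; apply: le_trans (le_inflow _ w_pi) _; rewrite cpi_inv.
have w_summable : (\esum_(x in [set: S]) (outflow w x)%:E < +oo)%E.
  apply: (@le_lt_trans _ _ (\esum_(x in [set: S]) (c%:E * (outflow pi x)%:E))%E).
    by apply: le_esum => x _; rewrite -EFinM lee_fin /outflow mulrA ler_wpM2r.
  rewrite esumZl//; last by move=> x; exact: out0.
  rewrite lte_mul_pinfty ?lee_fin//.
(* The totals of inflow and outflow agree, and are finite because [w] lies below a multiple of [pi];
   so the termwise inequality is an equality. *)
have w_inv x : inflow w x = (outflow w x)%:E.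
  apply: (eq_esum_termwise (b := fun x => (outflow w x)%:E)) => //.
    by move=> {}x; exact: inflow_ge0.
  exact: total_inflow.
have wE := w_inv z; have cE := cpi_inv z.
(* By the choice of [c], [w] and [c * pi] agree at [z], hence have the same outflow and so the same
   inflow there. As [w] lies below [c * pi], every contribution to that inflow agrees, in particular
   the positive share [K] coming from [y]. *)
have flowE : inflow w z = inflow (fun y => c * pi y) z.
  by rewrite wE cE /outflow wz -czE mulrA.
pose K := \sum_j a j y * (T j y == z)%:R.
have K0 : 0 < K.
  rewrite /K (bigD1 i)//= eqxx mulr1 ltr_wpDr// sumr_ge0// => j _.
  by rewrite mulr_ge0.
have [wy] : (w y * K)%:E = (c * pi y * K)%:E :> \bar R.
  pose cpi x := c * pi x.
  apply: (eq_esum_termwise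
    (a := fun y => (w y * \sum_j a j y * (T j y == z)%:R)%:E)
    (b := fun y => (cpi y * \sum_j a j y * (T j y == z)%:R)%:E)).
  - by move=> x; rewrite lee_fin flow_ge0.
  - move=> x; rewrite lee_fin ler_wpM2r//; apply: sumr_ge0 => j _.
    by rewrite mulr_ge0.
  - exact: flowE.
  - by rewrite -/(inflow cpi z) cE ltry.
rewrite ler_pdivlMr// -(mulIf _ wy) ?gt_eqF//.
Qed.

End subinvariant.

End jump_process.

(** * The zero-range process *)

Section particles.
Set Implicit Arguments.
Unset Strict Implicit.
Variable N : nat.
Implicit Types (x y : Lambda N) (z : config N nat).

Lemma add_particleK x : cancel (add_particle x) (@remove_particle N x).
Proof.
by move=> z; apply/ffunP => u; rewrite !ffunE; case: eqP.
Qed.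

Lemma remove_particleK x z : (0 < z x)%N -> add_particle x (remove_particle x z) = z.
Proof.
move=> zx; apply/ffunP => u; rewrite !ffunE; case: eqP => // ->.
by rewrite prednK.
Qed.

Lemma add_particle_same x z : add_particle x z x = (z x).+1.
Proof. by rewrite ffunE eqxx. Qed.

End particles.

Section zero_range_process.
Set Implicit Arguments.
Unset Strict Implicit.
Variables (R : realType) (N : nat) (g : nat -> R) (phi : Lambda N -> R).
Hypothesis g_mono : {homo g : k l / (k <= l)%N >-> k <= l}.
Hypothesis g0 : g 0%N = 0.
Hypothesis g_pos : forall k : nat, (1 <= k)%N -> 0 < g k.
Hypothesis phi_gt0 : forall x, 0 < phi x.
Notation S := (config N nat).
Implicit Types (x y : Lambda N) (z v : S) (w : S -> R).

Let g_ge0 k : 0 <= g k.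
Proof. by case: k => [|k]; [rewrite g0|rewrite ltW// g_pos]. Qed.

Definition zr_weight z : R := \prod_x ((gfact g (z x))^-1 * phi x ^+ z x).

Lemma zr_weight_gt0 z : 0 < zr_weight z.
Proof.
by apply: prodr_gt0 => x _; rewrite mulr_gt0 ?invr_gt0 ?gfact_gt0 ?exprn_gt0.
Qed.

Lemma zr_weight_add x v :
  zr_weight (add_particle x v) * g (v x).+1 = phi x * zr_weight v.
Proof.
rewrite /zr_weight (bigD1 x)//= [in RHS](bigD1 x)//= add_particle_same.
rewrite gfactS exprS; under eq_bigr => y yx do rewrite ffunE (negbTE yx).
have gf := gfact_gt0 g_pos (v x); have gv : 0 < g (v x).+1 by exact: g_pos.
by field; rewrite !gt_eqF.
Qed.

(** A finite set of configurations has bounded occupation numbers, so its weight is at most a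
    product of truncated partition functions, hence at most the product of the [Zfun g (phi x)]. *)
Lemma zr_weight_summable : (forall x, ((phi x)%:E < phistar g)%E) ->
  (\esum_(z in [set: S]) (zr_weight z)%:E < +oo)%E.
Proof.
move=> phis.
have cv x : cvgn (pseries (fun k => (gfact g k)^-1) (phi x)).
  have [r phir cr] := lt_phistar_cvg g_mono g_pos (ltW (phi_gt0 x)) (phis x).
  apply: is_cvg_pseries_inside cr _.
  by rewrite !gtr0_norm// (lt_trans (phi_gt0 x)).
pose t x k : R := (gfact g k)^-1 * phi x ^+ k.
have t0 x k : 0 <= t x k.
  by rewrite mulr_ge0 ?exprn_ge0 ?(ltW (phi_gt0 x))// invr_ge0 ltW// gfact_gt0.
pose Z := \prod_x Zfun g (phi x).
apply: (@le_lt_trans _ _ Z%:E); last exact: ltry.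
apply: ge_ereal_sup => _ [X [finX _] <-].
rewrite fsbig_finite//= sumEFin lee_fin.
set s : seq S := finmap.enum_fset (fset_set X).
have s_uniq : uniq s by exact: finmap.fset_uniq.
pose K := \max_(z <- s) \max_x z x.
have zK z x : z \in s -> (z x < K.+1)%N.
  move=> zs; rewrite ltnS (leq_trans (leq_bigmax x))//.
  exact: (leq_bigmax_seq (F := fun z : S => \max_x z x)).
pose h z : {ffun Lambda N -> 'I_K.+1} := [ffun x => inord (z x)].
have h_inj : {in s &, injective h}.
  move=> u v us vs /ffunP uv; apply/ffunP => x.
  have := uv x; rewrite !ffunE => /(congr1 val).
  by rewrite /= !inordK ?zK.
pose q (f : {ffun Lambda N -> 'I_K.+1}) := \prod_x t x (f x).
have q0 f : 0 <= q f by rewrite prodr_ge0.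
apply: (@le_trans _ _ (\sum_f q f)).
  have -> : \sum_(z <- s) zr_weight z = \sum_(f <- [seq h z | z <- s]) q f.
    rewrite big_map big_seq [RHS]big_seq; apply: eq_bigr => z zs.
    by apply: eq_bigr => x _; rewrite ffunE inordK ?zK.
  rewrite big_uniq/= ?map_inj_in_uniq//.
  by rewrite big_mkcond ler_sum// => f _; case: ifP.
rewrite /q -(bigA_distr_bigA (fun x k => t x (k : 'I_K.+1)))/=.
apply: ler_prod => x _; rewrite sumr_ge0//=.
rewrite -(big_mkord xpredT (t x)).
apply: (nondecreasing_cvgn_le _ (cv x)).
apply/nondecreasing_seqP => n; rewrite /pseries /series/= big_nat_recr//= lerDl.
exact: t0.
Qed.

(* Summed over [v], this identity says that a probability [w] satisfies
   [E_w [g (xi x)] = phi x]. *)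
Definition zr_tilted w := forall x v, w (add_particle x v) * g (v x).+1 = phi x * w v.

(** The only candidate for a preimage of [z] is [remove_particle x z]. If [z x = 0] there is none,
    which matches [g 0 = 0]. *)
Lemma zr_tilted_add x w z : (forall v, 0 <= w v) -> zr_tilted w ->
  ((phi x)%:E * (\esum_(v in [set: S]) ((w v)%:E * (add_particle x v == z)%:R%:E))
   = (w z * g (z x))%:E)%E.
Proof.
move=> w0 wt; rewrite (esum_preimage (u := remove_particle x z)); last 2 first.
  by move=> v; rewrite lee_fin.
  by move=> v _ <-; rewrite add_particleK.
have [zx|zx] := posnP (z x).
  rewrite zx g0 mulr0; case: eqP => [/(congr1 (fun f : S => f x))|_].
    by rewrite add_particle_same zx.
  by rewrite !mule0.
rewrite remove_particleK// eqxx mule1 -EFinM -wt remove_particleK//.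
by rewrite -[in LHS](add_particle_same x) remove_particleK.
Qed.

Lemma zr_tilted_esum x w : (forall v, 0 <= w v) -> zr_tilted w ->
  (\esum_(z in [set: S]) (w z * g (z x))%:E
   = (phi x)%:E * (\esum_(z in [set: S]) (w z)%:E))%E.
Proof.
move=> w0 wt; under eq_esum do rewrite -(zr_tilted_add _ _ w0 wt).
rewrite esumZl ?(ltW (phi_gt0 x))//; last first.
  by move=> z; apply: esum_ge0 => v _; rewrite mule_ge0// lee_fin// ler0n.
by rewrite esum_fiber// => z; rewrite lee_fin.
Qed.

Lemma zr_add_flow x w z : (forall v, 0 <= w v) -> zr_tilted w ->
  (\esum_(v in [set: S]) (w v * (add_particle x v == z)%:R)%:E
   = (w z * g (z x) / phi x)%:E)%E.
Proof.
move=> w0 wt; rewrite mulrC EFinM -(zr_tilted_add _ _ w0 wt) muleA -EFinM.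
rewrite mulVf ?gt_eqF// mul1e; exact: eq_esum.
Qed.

Lemma zr_remove_flow x w z : (forall v, 0 <= w v) -> zr_tilted w ->
  (\esum_(v in [set: S]) (w v * g (v x) * (remove_particle x v == z)%:R)%:E
   = (phi x * w z)%:E)%E.
Proof.
move=> w0 wt; under eq_esum do rewrite EFinM.
rewrite (esum_preimage (u := add_particle x z)); last 2 first.
- by move=> v; rewrite lee_fin mulr_ge0.
- move=> v; have [vx|vx _ <-] := posnP (v x); last by rewrite remove_particleK.
  by rewrite vx g0 mulr0 eqxx.
by rewrite add_particleK eqxx mule1 add_particle_same wt.
Qed.

(** A move is a removal at [x] followed by an addition at [y], so the tilting identity is used once
    at each of the two sites. *)
Lemma zr_move_flow x y w z : (forall v, 0 <= w v) -> zr_tilted w ->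
  (\esum_(v in [set: S]) (w v * g (v x) * (move_particle x y v == z)%:R)%:E
   = (phi x * (w z * g (z y) / phi y))%:E)%E.
Proof.
move=> w0 wt; under eq_esum do rewrite EFinM.
rewrite (esum_preimage (u := add_particle x (remove_particle y z))); last 2 first.
- by move=> v; rewrite lee_fin mulr_ge0.
- move=> v; have [vx|vx _ <-] := posnP (v x).
    by rewrite vx g0 mulr0 eqxx.
  by rewrite /move_particle add_particleK remove_particleK.
rewrite /move_particle add_particleK add_particle_same wt EFinM -muleA EFinM.
rewrite -(zr_add_flow _ _ w0 wt); congr (_ * _)%E.
under eq_esum do rewrite EFinM.
rewrite (esum_preimage (u := remove_particle y z))//.
by move=> v _ <-; rewrite add_particleK.
Qed.

Variables (W : Lambda N -> Lambda N -> R) (A B : Lambda N -> R).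
Hypothesis W_ge0 : forall x y, 0 <= W x y.
Hypothesis W_sym : forall x y, W x y = W y x.
Hypothesis A_gt0 : forall x, 0 < A x.
Hypothesis B_gt0 : forall x, 0 < B x.

Definition zr_jump (i : Lambda N * Lambda N + (Lambda N + Lambda N)) z : S :=
  match i with
  | inl xy => move_particle xy.1 xy.2 z
  | inr (inl x) => add_particle x z
  | inr (inr x) => remove_particle x z
  end.

Definition zr_rate (i : Lambda N * Lambda N + (Lambda N + Lambda N)) z : R :=
  match i with
  | inl xy => W xy.1 xy.2 * g (z xy.1)
  | inr (inl x) => A x
  | inr (inr x) => B x * g (z x)
  end.

Lemma zr_rate_ge0 i z : 0 <= zr_rate i z.
Proof. by case: i => [[x y]|[x|x]] /=; rewrite ?mulr_ge0// ltW. Qed.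

Hypothesis traffic : forall x,
  phi x * (\sum_y W x y + B x) = \sum_y phi y * W x y + A x.

(** The terms carrying [g (z x)] balance by the traffic equation at [x]; those without [g] balance
    by the sum of the traffic equations over all sites. *)
Lemma zr_tilted_invariant w z : (forall v, 0 <= w v) -> zr_tilted w ->
  inflow zr_jump zr_rate w z = (outflow zr_rate w z)%:E.
Proof.
move=> w0 wt; rewrite inflow_sum//; last exact: zr_rate_ge0.
pose flow (i : Lambda N * Lambda N + (Lambda N + Lambda N)) : R :=
  match i with
  | inl xy => W xy.1 xy.2 * (phi xy.1 * (w z * g (z xy.2) / phi xy.2))
  | inr (inl x) => A x * (w z * g (z x) / phi x)
  | inr (inr x) => B x * (phi x * w z)
  end.
rewrite (eq_bigr (fun i => (flow i)%:E)) => [|[[x y]|[x|x]] _ /=].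
- rewrite sumEFin /outflow mulr_sumr !big_sumType/=; congr EFin.
  rewrite -!(pair_bigA _ (fun x y => W x y * (phi x * (w z * g (z y) / phi y))))/=.
  rewrite -!(pair_bigA _ (fun x y => w z * (W x y * g (z x))))/=.
  (* The bulk terms cancel in the sum over [x] because [W] is symmetric. *)
  have traffic_sum : \sum_x B x * phi x = \sum_x A x.
    have : \sum_x phi x * (\sum_y W x y + B x) = \sum_x (\sum_y phi y * W x y + A x).
      by apply: eq_bigr => x _; exact: traffic.
    under eq_bigr do rewrite mulrDr mulr_sumr.
    rewrite !big_split/= [X in X + _]exchange_big/=.
    under [X in X + _]eq_bigr do under eq_bigr do rewrite W_sym.
    move=> /addrI; under eq_bigr do rewrite mulrC; done.
  have -> : \sum_x B x * (phi x * w z) = \sum_x w z * A x.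
    by rewrite -mulr_sumr -traffic_sum mulr_sumr; apply: eq_bigr => x _; ring.
  rewrite [LHS]addrA [RHS]addrCA [RHS]addrC; congr (_ + _).
  rewrite exchange_big/= -!big_split/=; apply: eq_bigr => x _.
  have px : phi x != 0 by rewrite gt_eqF.
  rewrite -mulr_sumr -mulr_suml.
  have -> : \sum_i W i x * (phi i * (w z * g (z x) / phi x))
      = (\sum_y phi y * W x y) * (w z * g (z x) / phi x).
    by rewrite mulr_suml; apply: eq_bigr => y _; rewrite W_sym; ring.
  have -> : \sum_y phi y * W x y = phi x * (\sum_y W x y + B x) - A x.
    by rewrite traffic addrK.
  by field.
- under eq_esum => v _ do rewrite mulrCA -mulrA EFinM.
  rewrite esumZl// ?zr_move_flow// => v.
  by rewrite lee_fin !mulr_ge0.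
- under eq_esum => v _ do rewrite [w v * _]mulrC -mulrA EFinM.
  rewrite esumZl// ?zr_add_flow// ?(ltW (A_gt0 x))// => v.
  by rewrite lee_fin !mulr_ge0.
- under eq_esum => v _ do rewrite mulrCA -mulrA EFinM.
  rewrite esumZl// ?zr_remove_flow// ?(ltW (B_gt0 x))// => v.
  by rewrite lee_fin !mulr_ge0.
Qed.

Let weight_ge0 z : 0 <= zr_weight z.
Proof. exact/ltW/zr_weight_gt0. Qed.

(** Every rate is constant or a multiple of some [g (z x)], whose total against a tilted weight is
    [phi x] times the mass. *)
Lemma zr_outflow_summable : (forall x, ((phi x)%:E < phistar g)%E) ->
  (\esum_(z in [set: S]) (outflow zr_rate zr_weight z)%:E < +oo)%E.
Proof.
move=> phis; have sw := zr_weight_summable phis.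
have outE z : (outflow zr_rate zr_weight z)%:E
    = (\sum_i (zr_weight z * zr_rate i z)%:E)%E.
  by rewrite sumEFin /outflow mulr_sumr.
under eq_esum do rewrite outE.
rewrite esum_sum; last first.
  by move=> z i _ _; rewrite lee_fin mulr_ge0// zr_rate_ge0.
apply: lte_sum_pinfty => i _.
have fin_flow x : (\esum_(z in [set: S]) (zr_weight z * g (z x))%:E < +oo)%E.
  rewrite (zr_tilted_esum _ _ zr_weight_add)// lte_mul_pinfty ?lee_fin//.
  exact: ltW.
have scaled c (h : S -> R) : 0 <= c -> (forall z, 0 <= h z) ->
    (\esum_(z in [set: S]) (h z)%:E < +oo)%E ->
    (\esum_(z in [set: S]) (c * h z)%:E < +oo)%E.
  move=> c0 h0 hoo; under eq_esum do rewrite EFinM.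
  by rewrite esumZl// ?lte_mul_pinfty ?lee_fin// => z; rewrite lee_fin.
case: i => [[x y]|[x|x]] /=.
- under eq_esum do rewrite mulrCA.
  by apply: scaled => // z; rewrite mulr_ge0.
- under eq_esum do rewrite mulrC.
  by apply: scaled => //; exact: ltW.
- under eq_esum do rewrite mulrCA.
  by apply: scaled => // [|z]; [exact: ltW|rewrite mulr_ge0].
Qed.

(** Adding a particle at [x] and removing it again both have positive rate, so
    [subinvariant_ratio_le] applies in both directions and [nu] has the same increments as
    [zr_weight]. *)
Lemma zr_subinvariant_tilted (nu : S -> R) :
  (forall x, ((phi x)%:E < phistar g)%E) -> (forall z, 0 <= nu z) ->
  (forall z, (inflow zr_jump zr_rate nu z <= (outflow zr_rate nu z)%:E)%E) ->
  zr_tilted nu.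
Proof.
move=> phis nu0 nus x v.
have ratio_le i z : 0 < zr_rate i z ->
    nu (zr_jump i z) / zr_weight (zr_jump i z) <= nu z / zr_weight z.
  apply: subinvariant_ratio_le => //.
  - exact: zr_rate_ge0.
  - exact: zr_weight_gt0.
  - by move=> u; apply: zr_tilted_invariant => //; exact: zr_weight_add.
  - exact: zr_outflow_summable.
have ratio : nu (add_particle x v) / zr_weight (add_particle x v)
    = nu v / zr_weight v.
  apply/eqP; rewrite eq_le (ratio_le (inr (inl x)))//=.
  have := ratio_le (inr (inr x)) (add_particle x v).
  by rewrite /= add_particleK add_particle_same; apply; rewrite mulr_gt0// g_pos.
have w0 z : zr_weight z != 0 by rewrite gt_eqF// zr_weight_gt0.
rewrite -[nu (add_particle x v)](divfK (w0 (add_particle x v))) ratio.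
by rewrite -mulrA zr_weight_add; field.
Qed.

End zero_range_process.

(** * Balance equations and the traffic equation *)

Section stationary_jump_process.
Set Implicit Arguments.
Unset Strict Implicit.
Context (d : measure_display) (S : measurableType d) (R : realType).
Variables (I : finType) (T : I -> S -> S) (a : I -> S -> R).
Variables (L : (S -> R) -> S -> R) (m : probability S R).
Hypothesis discreteS : forall A : set S, measurable A.
Hypothesis LE : forall f y, L f y = \sum_i a i y * (f (T i y) - f y).
Hypothesis m_stationary : stationary_measure L m.

(** Each finite partial sum is enlarged to include [z], so that the loss term [outflow] appears when
    the finite test of subinvariance is applied. *)
Lemma stationary_inflow_le z : (forall i y, 0 <= a i y) ->
  (inflow T a (fun y => fine (m [set y])) z
   <= (outflow a (fun y => fine (m [set y])) z)%:E)%E.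
Proof.
move=> a0; apply: ge_ereal_sup => _ [X [finX _] <-].
have flow0 y : 0 <= fine (m [set y]) * (\sum_i a i y * (T i y == z)%:R).
  by rewrite mulr_ge0 ?fine_ge0// sumr_ge0// => i _; rewrite mulr_ge0.
have finXz : finite_set (X `|` [set z]) by rewrite finite_setU.
apply: (@le_trans _ _ (\sum_(y \in X `|` [set z])
    (fine (m [set y]) * (\sum_i a i y * (T i y == z)%:R))%:E)%E).
  apply: lee_fsum_nneg_subset => //; first exact/subsetP/subsetUl.
  by move=> y _; rewrite lee_fin.
rewrite fsbig_finite//= sumEFin lee_fin.
set s : seq S := finmap.enum_fset (fset_set (X `|` [set z])).
have s_uniq : uniq s by exact: finmap.fset_uniq.
have zs : z \in s by rewrite in_fset_set// inE; right.
have := stationary_measure_subinvariant discreteS m_stationary s_uniq zs.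
under eq_bigr => y _.
  rewrite LE; under eq_bigr do rewrite !indicE mulrBr !in_set1.
  rewrite sumrB mulrBr.
  over.
rewrite sumrB subr_le0 => /le_trans; apply.
rewrite (bigD1_seq z)//= [X in _ + X]big1 ?addr0 => [|y yz].
  by rewrite /outflow; under eq_bigr do rewrite eqxx mulr1.
by rewrite big1 ?mulr0// => i _; rewrite (negbTE yz) mulr0.
Qed.

(** On a finite space the defects [e z] are all nonpositive, and their sum is the average of
    [L 1 = 0]; so each vanishes, and linearity extends this from indicators to [f]. *)
Lemma stationary_finite_balance (s : seq S) (f : S -> R) :
  uniq s -> (forall y, y \in s) -> \sum_(y <- s) fine (m [set y]) * L f y = 0.
Proof.
move=> s_uniq s_all.
pose e z := \sum_(y <- s) fine (m [set y]) * L \1_[set z] y.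
have pick_at (h : S -> R) x : \sum_(z <- s) h z * \1_[set z] x = h x.
  rewrite (bigD1_seq x)//= indicE in_set1 eqxx mulr1 big1 ?addr0// => z zx.
  by rewrite indicE in_set1 eq_sym (negbTE zx) mulr0.
have LfE h y : L h y = \sum_(z <- s) h z * L \1_[set z] y.
  under eq_bigr do rewrite LE mulr_sumr.
  rewrite exchange_big LE; apply: eq_bigr => i _ /=.
  under eq_bigr do rewrite mulrCA mulrBr.
  by rewrite -mulr_sumr sumrB !pick_at.
have sumE h : \sum_(y <- s) fine (m [set y]) * L h y = \sum_(z <- s) h z * e z.
  under eq_bigr do rewrite LfE mulr_sumr.
  rewrite exchange_big; apply: eq_bigr => z _ /=.
  by rewrite /e mulr_sumr; apply: eq_bigr => y _; rewrite mulrCA.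
have e_le0 z : e z <= 0 by exact: stationary_measure_subinvariant.
have L1 y : L (fun=> 1) y = 0.
  by rewrite LE big1// => i _; rewrite subrr mulr0.
have sum_e : \sum_(z <- s) e z = 0.
  rewrite -[RHS](_ : \sum_(y <- s) fine (m [set y]) * L (fun=> 1) y = 0).
    by rewrite sumE; under [RHS]eq_bigr do rewrite mul1r.
  by rewrite big1// => y _; rewrite L1 mulr0.
have e0 z : e z = 0.
  apply/eqP; rewrite eq_le e_le0/= -sum_e (bigD1_seq z)//= gerDl.
  by apply: sumr_le0.
by rewrite sumE big1// => z _; rewrite e0 mulr0.
Qed.

End stationary_jump_process.

Section traffic.
Set Implicit Arguments.
Unset Strict Implicit.
Variables (R : realType) (X : finType) (W : X -> X -> R) (B : X -> R).
Hypothesis W_ge0 : forall x y, 0 <= W x y.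
Hypothesis B_gt0 : forall x, 0 < B x.

(** At a maximum point with a positive value the right side is at most [D x] times the sum of
    [W x y], and the absorption [B x > 0] gives a contradiction. *)
Lemma traffic_max_principle (D : X -> R) :
  (forall x, D x * (\sum_y W x y + B x) <= \sum_y D y * W x y) ->
  forall x, D x <= 0.
Proof.
move=> Dsub x0; rewrite leNgt; apply/negP => Dx0.
case: (@Order.TotalTheory.arg_maxP _ _ _ x0 xpredT D) => // x _ Dmax.
have Dx : 0 < D x by exact: lt_le_trans (Dmax x0 _).
have := Dsub x; rewrite mulrDr; apply/negP; rewrite -ltNge.
apply: (@le_lt_trans _ _ (D x * \sum_y W x y)).
  by rewrite mulr_sumr ler_sum// => y _; rewrite ler_wpM2r//; exact: Dmax.
by rewrite ltrDl mulr_gt0.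
Qed.

End traffic.

(** * Positivity and symmetry of the jump law *)

Section jump_law_theory.
Set Implicit Arguments.
Unset Strict Implicit.
Variables (R : realType) (gamma c : R).
Hypothesis c_gt0 : 0 < c.
Hypothesis p_sum1 : (\esum_(z in [set: int]) (jump_law c gamma z)%:E = 1)%E.
Notation p := (jump_law c gamma).

Lemma jump_law_ge0 z : 0 <= p z.
Proof. by rewrite /jump_law; case: eqP => // _; rewrite mulr_ge0 ?powR_ge0// ltW. Qed.

Lemma jump_law_gt0 z : z != 0 -> 0 < p z.
Proof.
move=> z0; rewrite /jump_law (negbTE z0) mulr_gt0// powR_gt0//.
by rewrite ltr0n absz_gt0.
Qed.

Lemma jump_lawN z : p (- z) = p z.
Proof. by rewrite /jump_law oppr_eq0 abszN. Qed.

Lemma jump_law_shift_esum_le1 (A : set int) (x : int) :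
  (\esum_(y in A) (p (y - x))%:E <= 1)%E.
Proof.
rewrite -p_sum1 (reindex_esum [set: int] [set: int] (fun y => y - x)).
  rewrite [leLHS]esum_mkcond; apply: le_esum => y _.
  by case: ifP => // _; rewrite lee_fin jump_law_ge0.
split=> //; first by move=> u v _ _ /addIr.
by move=> z _; exists (z + x) => //; rewrite addrK.
Qed.

(** The target [N] alone contributes a positive amount. Finiteness matters too, since [fine] sends
    [+oo] to 0. *)
Lemma rplus_gt0 N (x : Lambda N) : 0 < rplus p x.
Proof.
apply: fine_gt0; apply/andP; split; last first.
  by apply: le_lt_trans (jump_law_shift_esum_le1 _ _) _; exact: ltry.
apply: (@lt_le_trans _ _ (p (N%:Z - site x))%:E).
  rewrite lte_fin jump_law_gt0// subr_eq0 /site eqz_nat.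
  by rewrite gtn_eqF// ltn_ord.
apply: esum_ge; exists [set N%:Z]; last by rewrite fsbig_set1.
by split => // y ->/=.
Qed.

Lemma rminus_ge0 N (x : Lambda N) : 0 <= rminus p x.
Proof.
by apply: fine_ge0; apply: esum_ge0 => y _; rewrite lee_fin jump_law_ge0.
Qed.

End jump_law_theory.

(** * The two boundary driven generators *)

Section generators.
Set Implicit Arguments.
Unset Strict Implicit.
Variables (R : realType) (p : int -> R) (kappa theta : R) (N : nat).
Notation k := (kappa / N%:R `^ theta).
Notation W := (fun x y : Lambda N => p (site y - site x)).
Notation rp := (rplus p (N := N)).
Notation rm := (rminus p (N := N)).

(** The two reservoirs merge into a single creation rate and a single removal coefficient per site,
    which are the source and absorption terms of the traffic equation. *)
Lemma zr_generatorE (g : nat -> R) (phi_l phi_r : R) f z :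
  zr_generator p kappa theta g phi_l phi_r f z
  = \sum_i zr_rate g W (fun x => k * (phi_r * rp x + phi_l * rm x))
             (fun x => k * (rp x + rm x)) i z
           * (f (zr_jump i z) - f z).
Proof.
rewrite /zr_generator /zr_bulk /zr_reservoir !big_sumType/= pair_bigA/=.
congr (_ + _); rewrite -!big_split/= mulr_sumr; apply: eq_bigr => x _; ring.
Qed.

Definition ex_jump (i : Lambda N * Lambda N + Lambda N) (eta : config N bool)
    : config N bool :=
  match i with inl xy => exchange xy.1 xy.2 eta | inr x => flip x eta end.

Definition ex_rate (rho_l rho_r : R) (i : Lambda N * Lambda N + Lambda N)
    (eta : config N bool) : R :=
  match i with
  | inl xy => 2^-1 * W xy.1 xy.2
  | inr x => k * (rp x * flip_rate x eta rho_r + rm x * flip_rate x eta rho_l)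
  end.

Lemma ex_generatorE (rho_l rho_r : R) f eta :
  ex_generator p kappa theta rho_l rho_r f eta
  = \sum_i ex_rate rho_l rho_r i eta * (f (ex_jump i eta) - f eta).
Proof.
rewrite /ex_generator /ex_bulk /ex_reservoir big_sumType/= pair_bigA/=.
congr (_ + _); first by rewrite mulr_sumr; apply: eq_bigr => x _; rewrite mulrA.
by rewrite -!big_split/= mulr_sumr; apply: eq_bigr => x _; ring.
Qed.

Hypothesis pN : forall z, p (- z) = p z.

(** The generator maps an occupation variable to an affine function of occupation variables, so the
    stationary means satisfy a closed system. The factor [2^-1] offsets counting each exchange once
    per ordering of its two sites. *)
Lemma ex_generator_occupation (rho_l rho_r : R) (x : Lambda N) eta :
  ex_generator p kappa theta rho_l rho_r (fun eta => (eta x)%:R) eta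
  = \sum_y W x y * ((eta y)%:R - (eta x)%:R)
    + k * (rp x * (rho_r - (eta x)%:R) + rm x * (rho_l - (eta x)%:R)).
Proof.
have reservoirE (r : Lambda N -> R) rho :
    ex_reservoir r rho (fun eta => (eta x)%:R) eta = r x * (rho - (eta x)%:R).
  rewrite /ex_reservoir (bigD1 x)//= big1 => [|y yx]; last first.
    by rewrite ffunE eq_sym (negbTE yx) subrr mulr0.
  rewrite ffunE eqxx /flip_rate addr0 -mulrA; congr (_ * _).
  by case: (eta x) => /=; ring.
rewrite /ex_generator !reservoirE; congr (_ + _); rewrite /ex_bulk.
have exE u v : ((exchange u v eta x)%:R - (eta x)%:R : R)
    = (x == u)%:R * ((eta v)%:R - (eta u)%:R) + (x == v)%:R * ((eta u)%:R - (eta v)%:R).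
  rewrite ffunE; have [<-|_] := eqVneq x u; have [<-|_] := eqVneq x v; rewrite /=; ring.
pose S := \sum_y W x y * ((eta y)%:R - (eta x)%:R).
have pick (F : Lambda N -> R) : \sum_u (x == u)%:R * F u = F x.
  rewrite (bigD1 x)//= eqxx mul1r big1 ?addr0// => u ux.
  by rewrite eq_sym (negbTE ux) mul0r.
suff -> : \sum_u \sum_v W u v * ((exchange u v eta x)%:R - (eta x)%:R) = S + S.
  by rewrite -/S; field.
under eq_bigr => u _ do under eq_bigr => v _ do rewrite exE mulrDr mulrCA [X in _ + X]mulrCA.
under eq_bigr do rewrite big_split/= -mulr_sumr.
rewrite big_split/= pick; congr (_ + _).
rewrite exchange_big/=; under eq_bigr do rewrite -mulr_sumr.
rewrite pick; apply: eq_bigr => u _.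
by rewrite -[in LHS]opprB pN.
Qed.

End generators.

Section discrete_configurations.
Set Implicit Arguments.
Unset Strict Implicit.
Variables (R : realType) (N : nat).

Lemma config_measurable (T : pointedType) (A : set (config N T)) : measurable A.
Proof. by []. Qed.

Lemma expectation_esum (T : pointedType) (code : config N T -> nat)
    (m : probability (config N T) R) (f : config N T -> R) :
  injective code -> (forall z, 0 <= f z) ->
  ('E_m[f] = \esum_(z in [set: config N T]) (fine (m [set z]) * f z)%:E)%E.
Proof.
move=> code_inj f0; rewrite unlock (ge0_integral_esum _ m code_inj)//.
apply: eq_esum => z _; rewrite mulrC EFinM fineK//.
exact: fin_num_measure.
Qed.

Lemma prob_esum1 (T : pointedType) (code : config N T -> nat)
    (m : probability (config N T) R) : injective code ->
  (\esum_(z in [set: config N T]) (fine (m [set z]))%:E = 1)%E.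
Proof.
move=> code_inj.
have <- : ('E_m[fun=> 1%R] = 1)%E by exact: expectation_cst.
by rewrite (expectation_esum _ code_inj)//; under [RHS]eq_esum do rewrite mulr1.
Qed.

End discrete_configurations.

(** * Positivity and monotonicity of the fugacity as a function of the density *)

Section inverse_of_Rfun.
Set Implicit Arguments.
Unset Strict Implicit.
Variables (R : realType) (g : nat -> R) (Phi : R -> R).

(** [Rfun] vanishes at 0, so [Phi a = 0] would force [a = 0]. *)
Lemma inverse_of_Rfun_gt0 (a : R) :
  inverse_of_Rfun g Phi -> 0 < a -> (a%:E < mstar g)%E -> 0 < Phi a.
Proof.
move=> [dom _ RPhi _] a0 am.
have da : densities g a by split => //; exact: ltW.
have [Phi0 _] := dom _ da; rewrite lt_neqAle Phi0 andbT; apply/eqP => Phia0.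
by have := RPhi _ da; rewrite /Rfun -Phia0 !mul0r => ae; rewrite -ae ltxx in a0.
Qed.

(** Weak monotonicity of [Rfun] suffices: [Phi b < Phi a] would give [b <= a], hence [a = b], which
    is absurd. *)
Lemma inverse_of_Rfun_homo (a b : R) :
  {homo g : k l / (k <= l)%N >-> k <= l} ->
  (forall k : nat, (1 <= k)%N -> 0 < g k) ->
  inverse_of_Rfun g Phi -> 0 <= a -> a <= b -> (b%:E < mstar g)%E ->
  Phi a <= Phi b.
Proof.
move=> g_mono g_pos [dom _ RPhi _] a0 ab bm.
have db : densities g b by split => //; exact: le_trans ab.
have da : densities g a by split => //; rewrite (le_lt_trans _ bm)// lee_fin.
have [Phia0 Phia] := dom _ da; have [Phib0 _] := dom _ db.
have [//|ba] := leP (Phi a) (Phi b).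
have := Rfun_homo g_mono g_pos Phib0 (ltW ba) Phia; rewrite !RPhi// => ba'.
have abE : a = b by apply/eqP; rewrite eq_le ab ba'.
by rewrite abE ltxx in ba.
Qed.

End inverse_of_Rfun.

Theorem proposition2p5 (R : realType) (gamma theta kappa c : R) (N : nat)
    (g : nat -> R) (Phi : R -> R) (alpha beta : R)
    (nu : probability (config N nat) R) (mu : probability (config N bool) R)
    (hgamma : 0 < gamma < 2) (hkappa : 0 < kappa) (hN : (2 <= N)%N)
    (hc : 0 < c)
    (hp : (\esum_(z in [set: int]) (jump_law c gamma z)%:E = 1)%E)
    (hg_mono : {homo g : k l / (k <= l)%N >-> k <= l})
    (hg0 : g 0%N = 0) (hg_pos : forall k : nat, (1 <= k)%N -> 0 < g k)
    (hPhi : inverse_of_Rfun g Phi)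
    (halpha : 0 < alpha) (hab : alpha <= beta)
    (hbeta : (beta%:E < mstar g)%E)
    (hnu : stationary_measure
       (zr_generator (jump_law c gamma) kappa theta g (Phi alpha) (Phi beta))
       nu)
    (hmu : stationary_measure
       (ex_generator (jump_law c gamma) kappa theta
          (Phi alpha / (Phi alpha + Phi beta))
          (Phi beta / (Phi alpha + Phi beta)))
       mu) :
  exists phi : Lambda N -> R,
    [/\ forall x, Phi alpha <= phi x <= Phi beta,
        traffic_equation (jump_law c gamma) kappa theta
          (Phi alpha) (Phi beta) phi,
        forall psi : Lambda N -> R,
          traffic_equation (jump_law c gamma) kappa theta
            (Phi alpha) (Phi beta) psi -> psi =1 phi &
        forall x : Lambda N,
          ('E_nu[fun xi => g (xi x)] =
            (Phi alpha + Phi beta)%:E * 'E_mu[fun eta => (eta x)%:R])%E /\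
          ((Phi alpha + Phi beta)%:E * 'E_mu[fun eta => (eta x)%:R] =
            (phi x)%:E)%E].
Proof.
have ha_lt : (alpha%:E < mstar g)%E by rewrite (le_lt_trans _ hbeta)// lee_fin.
have a0 := inverse_of_Rfun_gt0 hPhi halpha ha_lt.
have ab := inverse_of_Rfun_homo hg_mono hg_pos hPhi (ltW halpha) hab hbeta.
have b_phistar : ((Phi beta)%:E < phistar g)%E.
  have [dom _ _ _] := hPhi.
  have /dom[] // : densities g beta by split => //; lra.
set p := jump_law c gamma; set fl := Phi alpha in a0 ab *.
set fr := Phi beta in ab b_phistar *; set s := fl + fr.
pose k := kappa / N%:R `^ theta.
have k0 : 0 < k by rewrite divr_gt0// powR_gt0// ltr0n; exact: ltnW.
pose W (x y : Lambda N) := p (site y - site x).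
have W0 x y : 0 <= W x y by exact: jump_law_ge0.
have pN z : p (- z) = p z by exact: jump_lawN.
have Wsym x y : W x y = W y x by rewrite /W -pN opprB.
have s0 : 0 < s by rewrite /s; lra.
pose B (x : Lambda N) : R := k * (rplus p x + rminus p x).
pose A (x : Lambda N) : R := k * (fr * rplus p x + fl * rminus p x).
have rp0 (x : Lambda N) : 0 < rplus p x by exact: rplus_gt0.
have rm0 (x : Lambda N) : 0 <= rminus p x by exact: rminus_ge0.
have B0 x : 0 < B x by rewrite mulr_gt0// ltr_wpDr.
have A0 x : 0 < A x.
  rewrite mulr_gt0// ltr_wpDr ?mulr_ge0 ?(ltW a0)// mulr_gt0//; lra.
have trafficE phi : traffic_equation p kappa theta fl fr phi <->
    forall x, phi x * (\sum_y W x y + B x) = \sum_y phi y * W x y + A x.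
  by rewrite /traffic_equation powRN.
(* A comparison principle for sub- and supersolutions; it yields both the bounds and the
   uniqueness. *)
have traffic_le phi psi :
    (forall x, phi x * (\sum_y W x y + B x) - \sum_y phi y * W x y
             <= psi x * (\sum_y W x y + B x) - \sum_y psi y * W x y) ->
    forall x, phi x <= psi x.
  move=> h x; rewrite -subr_le0.
  apply: (traffic_max_principle W0 B0 (D := fun x => phi x - psi x)) => {}x /=.
  under [leRHS]eq_bigr do rewrite mulrBl.
  by rewrite sumrB mulrBl; have := h x; lra.
have traffic_cst b x : b * (\sum_y W x y + B x) - \sum_y b * W x y = b * B x.
  by rewrite mulrDr mulr_sumr addrAC subrr add0r.
pose states : seq (config N bool) := enum {ffun Lambda N -> bool}.
have states_uniq : uniq states by exact: enum_uniq.
have states_all eta : eta \in states by rewrite /states mem_enum.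
have esum_states (f : config N bool -> R) : (forall eta, 0 <= f eta) ->
    (\esum_(eta in [set: config N bool]) (f eta)%:E
     = \sum_(eta <- states) (f eta)%:E)%E.
  move=> f0; have statesT : [set: config N bool] = [set` states].
    by apply/seteqP; split => // eta _; exact: states_all.
  rewrite statesT esum_fset; last 2 first.
  - exact: finite_seq.
  - by move=> eta _; rewrite lee_fin.
  by rewrite -fsbig_seq.
pose code (T : countType) (z : config N T) := pickle (z : {ffun Lambda N -> T}).
have code_inj (T : countType) : injective (@code T).
  by move=> u v; exact: (pcan_inj (@pickleK {ffun Lambda N -> T})).
pose mean x := \sum_(eta <- states) fine (mu [set eta]) * (eta x)%:R.
have mass1 : \sum_(eta <- states) fine (mu [set eta]) = 1.
  apply: EFin_inj; rewrite -sumEFin -(prob_esum1 mu (code_inj bool)).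
  by rewrite esum_states// => eta; exact: fine_ge0.
pose phi x := s * mean x.
have mean_mu x : ('E_mu[fun eta => (eta x)%:R] = (mean x)%:E)%E.
  rewrite (expectation_esum _ (code_inj bool))//.
  by rewrite esum_states ?sumEFin// => eta; rewrite mulr_ge0 ?fine_ge0.
have phi_traffic x : phi x * (\sum_y W x y + B x) = \sum_y phi y * W x y + A x.
  have := stationary_finite_balance (config_measurable (T := bool))
    (ex_generatorE _ _ _ _ _) hmu (fun eta => (eta x)%:R) states_uniq states_all.
  under eq_bigr do rewrite (ex_generator_occupation _ _ pN) mulrDr mulr_sumr.
  rewrite big_split/= exchange_big/= => balance.
  (* Dividing the reservoir fugacities by [s] produces the source [A x / s]; the factor [s] in [phi]
     restores [A x]. *)
  have bulkE : \sum_y W x y * (mean y - mean x) + (A x / s - mean x * B x) = 0.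
    rewrite -[RHS]balance; congr (_ + _).
      apply: eq_bigr => y _; rewrite /mean -sumrB mulr_sumr.
      by apply: eq_bigr => eta _; rewrite /W; ring.
    (* The constant source is averaged against [mu] by multiplying it with the total mass 1. *)
    rewrite -[A x / s]mulr1 -[X in _ * X]mass1 mulr_sumr mulr_suml -sumrB.
    by apply: eq_bigr => eta _; rewrite /A /B /k -/fl -/fr -/s; ring.
  have -> : \sum_y phi y * W x y
      = s * (\sum_y W x y * (mean y - mean x)) + phi x * \sum_y W x y.
    by rewrite !mulr_sumr -big_split/=; apply: eq_bigr => y _; rewrite /phi; ring.
  have -> : \sum_y W x y * (mean y - mean x) = mean x * B x - A x / s by lra.
  by rewrite /phi; field; rewrite gt_eqF.
have phi_bounds x : fl <= phi x <= fr.
  apply/andP; split.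
  (* The constants [fl] and [fr] are a sub- and a supersolution because [fl <= fr]. *)
  - apply: (traffic_le (fun=> fl)) => {}x.
    rewrite traffic_cst phi_traffic addrAC subrr add0r /A /B mulrCA ler_pM2l//.
    by have := rp0 x; have := rm0 x; nra.
  - apply: (traffic_le _ (fun=> fr)) => {}x.
    rewrite traffic_cst phi_traffic addrAC subrr add0r /A /B mulrCA ler_pM2l//.
    by have := rp0 x; have := rm0 x; nra.
exists phi; split.
- exact: phi_bounds.
- exact/trafficE.
- move=> psi /trafficE psi_traffic x; apply/eqP; rewrite eq_le.
  by apply/andP; split; apply: traffic_le => {}x;
    rewrite psi_traffic phi_traffic !(addrAC _ _ (- _)) !subrr.
move=> x; rewrite mean_mu; split => //.
(* The bounds on [phi] keep every fugacity positive and below [phistar g], as the product weight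
   requires. *)
have phi0 y : 0 < phi y by have /andP[h _] := phi_bounds y; exact: lt_le_trans h.
have phi_phistar y : ((phi y)%:E < phistar g)%E.
  have /andP[_ h] := phi_bounds y; by rewrite (le_lt_trans _ b_phistar)// lee_fin.
have nu_tilted : zr_tilted g phi (fun z => fine (nu [set z])).
  apply: (zr_subinvariant_tilted hg_mono hg0 hg_pos phi0 W0 Wsym A0 B0) => //.
    by move=> z; exact: fine_ge0.
  move=> z; apply: (stationary_inflow_le (config_measurable (T := nat))
    (zr_generatorE _ _ _ _ _ _) hnu).
  by move=> i y; exact: zr_rate_ge0.
rewrite (expectation_esum _ (code_inj nat)); last first.
  by move=> z; case: (z x) => [|n]; rewrite ?hg0// ltW// hg_pos.
rewrite (zr_tilted_esum hg0 phi0 _ _ nu_tilted); last first.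
  by move=> z; exact: fine_ge0.
by rewrite (prob_esum1 _ (code_inj nat)) mule1.
Qed.
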